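(* In the $d$-dimensional pseudo-Euclidean space $\mathbf{E}^{k,l}$, consider a billiard trajectory within the ellipsoid $\mathcal{E}=\mathcal{Q}_0$, and let quadrics $\mathcal{Q}_{\alpha_1},\dots,\mathcal{Q}_{\alpha_{d-1}}$ from the confocal family $(\mathcal{Q}_\lambda)$ be its caustics. Then all billiard trajectories within $\mathcal{E}$ sharing the same caustics are of the same type: space-like, time-like, or light-like, as the initial trajectory. Moreover, the type is determined as follows: \begin{itemize} \item if $\infty\in\{\alpha_1,\dots,\alpha_{d-1}\}$, the trajectories are light-like; \item if $(-1)^l\cdot\alpha_1\cdot\ldots\cdot\alpha_{d-1}>0$, the trajectories are space-like; \item if $(-1)^l\cdot\alpha_1\cdot\ldots\cdot\alpha_{d-1}<0$, the trajectories are time-like. \end{itemize}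
   Context: Let $k,l\ge1$, $d=k+l$. The pseudo-Euclidean space $\mathbf{E}^{k,l}$ is $\mathbf{R}^d$ with the scalar product $\langle x,y\rangle_{k,l}=x_1y_1+\dots+x_ky_k-x_{k+1}y_{k+1}-\dots-x_dy_d$; $\circ$ denotes the standard Euclidean product. A line with direction vector $v$ is space-like, time-like or light-like if $\langle v,v\rangle_{k,l}$ is $>0$, $<0$ or $=0$. Put $\varepsilon_i=1$ for $i\le k$, $\varepsilon_i=-1$ for $i>k$. Fix positive constants with $a_1>\dots>a_k>0>-a_{k+1}>\dots>-a_d$. The confocal family is $\mathcal{Q}_\lambda:\ \sum_{i=1}^d\frac{x_i^2}{a_i-\varepsilon_i\lambda}=1$, $\lambda\in\mathbf{R}$, where $\mathcal{Q}_{\varepsilon_ia_i}$ is understood as the coordinate hyperplane $x_i=0$, together with the hyperplane at infinity $\mathcal{Q}_\infty$; $\mathcal{E}=\mathcal{Q}_0$. Billiard reflection of a vector $v$ on a hyperplane $\alpha$: decompose $v=u+n_\alpha$ with $u$ in $\alpha$ and $n_\alpha$ orthogonal to $\alpha$ with respect to $\langle\cdot,\cdot\rangle_{k,l}$; the reflected vector is $v'=u-n_\alpha$. Billiard motion within $\mathcal{E}$ is uniform and straight inside $\mathcal{E}$ and obeys this reflection law with respect to the tangent hyperplane of $\mathcal{E}$ at boundary points; at points where the tangent hyperplane contains its orthogonal vector, $v$ is reflected into $-v$. Reflection preserves the type of line, so all segments of a trajectory have the same type, which is the type of the trajectory. With $A_\lambda=\mathrm{diag}\left(\frac1{a_i-\varepsilon_i\lambda}\right)$,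 the line $x+tv$ is tangent to $\mathcal{Q}_\lambda$ if $(A_\lambda x\circ v)^2-(A_\lambda v\circ v)(A_\lambda x\circ x-1)=0$; the left-hand side equals $\mathcal{P}(\lambda)/\prod_i(a_i-\varepsilon_i\lambda)$ with $\mathcal{P}$ a polynomial regarded as having degree $d-1$, with roots counted with multiplicity and missing roots (for light-like lines) equal to $\infty$. All segments of a billiard trajectory within $\mathcal{E}$ are tangent to the same $d-1$ quadrics $\mathcal{Q}_{\alpha_1},\dots,\mathcal{Q}_{\alpha_{d-1}}$, the $\alpha_j$ being the roots of $\mathcal{P}$ (in $\mathbf{R}\cup\{\infty\}$); these quadrics are the caustics of the trajectory. *)

(* Defs.v *)
From mathcomp Require Import all_boot all_order all_algebra.
From mathcomp Require Import classical_sets reals.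

Set Implicit Arguments.
Unset Strict Implicit.
Unset Printing Implicit Defensive.

Import Order.TTheory GRing.Theory Num.Theory.
Local Open Scope classical_set_scope.
Local Open Scope ring_scope.

Definition eps (R : realType) (k l : nat) (i : 'I_(k + l)) : R :=
  if (i < k)%N then 1 else -1.

Definition dot (R : realType) (d : nat) (x y : 'rV[R]_d) : R :=
  \sum_i x 0 i * y 0 i.

Definition pdot (R : realType) (k l : nat) (x y : 'rV[R]_(k + l)) : R :=
  \sum_i eps R i * (x 0 i * y 0 i).

Inductive line_type := SpaceLike | TimeLike | LightLike.

Definition vector_of_type (R : realType) (k l : nat) (tau : line_type)
    (v : 'rV[R]_(k + l)) : Prop :=
  match tau with
  | SpaceLike => 0 < pdot v v
  | TimeLike => pdot v v < 0
  | LightLike => pdot v v = 0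
  end.

(* All a_i are positive and eps_i a_i is strictly decreasing in i, i.e.
   a_1 > ... > a_k > 0 > - a_(k+1) > ... > - a_(k+l). *)
Definition admissible (R : realType) (k l : nat) (a : 'I_(k + l) -> R) : Prop :=
  (forall i, 0 < a i) /\
  (forall i j : 'I_(k + l), (i < j)%N -> eps R j * a j < eps R i * a i).

Definition Amx (R : realType) (k l : nat) (a : 'I_(k + l) -> R) (lam : R) :
    'M[R]_(k + l) :=
  diag_mx (\row_i (a i - eps R i * lam)^-1).

(* For admissible a the values eps_i a_i are pairwise distinct, so that the
   index found by pick is the only possible one. *)
Definition confocal (R : realType) (k l : nat) (a : 'I_(k + l) -> R) (lam : R) :
    set 'rV[R]_(k + l) :=
  [set x : 'rV[R]_(k + l) |
    if [pick i | lam == eps R i * a i] is Some i then x 0 i = 0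
    else dot (x *m Amx a lam) x = 1].

Definition ellipsoid (R : realType) (k l : nat) (a : 'I_(k + l) -> R) :
    set 'rV[R]_(k + l) :=
  confocal a 0.

Definition inside (R : realType) (k l : nat) (a : 'I_(k + l) -> R) :
    set 'rV[R]_(k + l) :=
  [set x : 'rV[R]_(k + l) | dot (x *m Amx a 0) x < 1].

(* The directions of the tangent hyperplane of the ellipsoid at its point x. *)
Definition tangent_plane (R : realType) (k l : nat) (a : 'I_(k + l) -> R)
    (x : 'rV[R]_(k + l)) : set 'rV[R]_(k + l) :=
  [set y : 'rV[R]_(k + l) | dot (x *m Amx a 0) y = 0].

Definition pseudo_orth (R : realType) (k l : nat) (H : set 'rV[R]_(k + l)) :
    set 'rV[R]_(k + l) :=
  [set n : 'rV[R]_(k + l) | forall y, H y -> pdot n y = 0].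

Definition contains_orthogonal (R : realType) (k l : nat)
    (H : set 'rV[R]_(k + l)) : Prop :=
  exists n, [/\ n != 0, H n & pseudo_orth H n].

Definition reflects (R : realType) (k l : nat) (H : set 'rV[R]_(k + l))
    (v v' : 'rV[R]_(k + l)) : Prop :=
  (contains_orthogonal H /\ v' = - v) \/
  (~ contains_orthogonal H /\
   exists u n, [/\ H u, pseudo_orth H n, v = u + n & v' = u - n]).

(* The initial point vertex 0 may lie inside the ellipsoid or on it; it is in
   the closed ellipsoid by segment_inside. *)
Record trajectory (R : realType) (k l : nat) (a : 'I_(k + l) -> R) :=
  Trajectory {
    vertex : nat -> 'rV[R]_(k + l);
    velocity : nat -> 'rV[R]_(k + l);
    flight_time : nat -> R;
    velocity_neq0 : forall n, velocity n != 0;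
    flight_time_gt0 : forall n, 0 < flight_time n;
    vertexS : forall n,
      vertex n.+1 = vertex n + flight_time n *: velocity n;
    vertexS_ellipsoid : forall n, ellipsoid a (vertex n.+1);
    segment_inside : forall n s, 0 < s < flight_time n ->
      inside a (vertex n + s *: velocity n);
    velocityS : forall n,
      reflects (tangent_plane a (vertex n.+1)) (velocity n) (velocity n.+1)
  }.

Definition trajectory_of_type (R : realType) (k l : nat) (a : 'I_(k + l) -> R)
    (tau : line_type) (T : trajectory a) : Prop :=
  forall n, vector_of_type tau (velocity T n).

Definition tangency (R : realType) (k l : nat) (a : 'I_(k + l) -> R)
    (x v : 'rV[R]_(k + l)) (lam : R) : R :=
  dot (x *m Amx a lam) v ^+ 2
  - dot (v *m Amx a lam) v * (dot (x *m Amx a lam) x - 1).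

(* This determines P uniquely: it prescribes the values of P at all but
   finitely many points. *)
Definition tangency_poly (R : realType) (k l : nat) (a : 'I_(k + l) -> R)
    (x v : 'rV[R]_(k + l)) (P : {poly R}) : Prop :=
  forall lam, (forall i, a i - eps R i * lam != 0) ->
    tangency a x v lam = P.[lam] / \prod_i (a i - eps R i * lam).

(* None is the parameter infinity; it contributes no linear factor.  Since
   alpha has k + l - 1 entries, None occurs as many times as P, regarded as a
   polynomial of degree k + l - 1, has missing roots. *)
Definition root_factor (R : realType) (alpha : option R) : {poly R} :=
  if alpha is Some r then 'X - r%:P else 1.

Definition line_caustics (R : realType) (k l : nat) (a : 'I_(k + l) -> R)
    (x v : 'rV[R]_(k + l)) (alpha : (k + l).-1.-tuple (option R)) : Prop :=
  exists2 P : {poly R}, tangency_poly a x v P &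
    P %= \prod_(r <- alpha) root_factor r.

Definition caustics (R : realType) (k l : nat) (a : 'I_(k + l) -> R)
    (T : trajectory a) (alpha : (k + l).-1.-tuple (option R)) : Prop :=
  forall n, line_caustics a (vertex T n) (velocity T n) alpha.

(* Main.v *)
(* Write P = c \prod_j (X - alpha_j), the roots at infinity being omitted, for the
   tangency polynomial of the line x + t v.  Its coefficient of degree d - 1 is
   - (-1)^k <v,v>, as one sees from the behaviour of the tangency condition near
   lam = oo.  Its value at 0 is positive: the tangency condition does not depend
   on the point chosen on the line, and at a point inside the ellipsoid its value
   at lam = 0 is positive because A_0 is positive definite.  So a root at infinity
   forces <v,v> = 0, and otherwise P(0) = c (-1)^(d-1) \prod_j alpha_j with
   c = - (-1)^k <v,v>, so that (-1)^l <v,v> \prod_j alpha_j > 0.  In both cases the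
   caustics alone determine the type, for each segment separately. *)
Require Import Defs.
From mathcomp Require Import all_boot all_order all_algebra.
From mathcomp Require Import classical_sets reals.
From mathcomp Require Import ring.

Set Implicit Arguments.
Unset Strict Implicit.
Unset Printing Implicit Defensive.

Import Order.TTheory GRing.Theory Num.Theory.
Local Open Scope ring_scope.

(** The product [(p - q) * z] vanishes everywhere, in particular at as many distinct integers as its
    size, so it is zero. *)
Lemma horner_ext_nonroots (R : numDomainType) (p q z : {poly R}) :
  z != 0 -> (forall x, ~~ root z x -> p.[x] = q.[x]) -> p = q.
Proof.
move=> z0 pq; apply/eqP; rewrite -subr_eq0; apply: contraT => d0.
have := max_poly_roots (rs := [seq i%:R | i <- iota 0 (size ((p - q) * z))])
  (mulf_neq0 d0 z0).
rewrite size_map size_iota ltnn => -> //.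
  apply/allP => x _; rewrite rootE hornerM hornerD hornerN.
  have [/rootP -> | /pq ->] := boolP (root z x); first by rewrite mulr0.
  by rewrite subrr mul0r.
by rewrite map_inj_uniq ?iota_uniq//; exact: mulrIn (oner_neq0 _).
Qed.

Section ConfocalFamily.
Variables (R : realType) (k l : nat) (a : 'I_(k + l) -> R).
Implicit Types (i : 'I_(k + l)) (x y v : 'rV[R]_(k + l)) (lam : R).

Lemma dot_Amx x y lam :
  dot (x *m Amx a lam) y = \sum_i x 0 i * y 0 i / (a i - eps R i * lam).
Proof.
by apply: eq_bigr => i _; rewrite /Amx mul_mx_diag !mxE mulrAC.
Qed.

(** Up to a factor 4, [tangency] is the discriminant in [t] of [dot ((x + t *: v) *m Amx a lam) (x +
    t *: v) - 1], which is invariant under translation of [t]. *)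
Lemma tangency_shift x v s lam :
  tangency a (x + s *: v) v lam = tangency a x v lam.
Proof.
rewrite /tangency !dot_Amx.
pose D i := a i - eps R i * lam.
set xv := \sum_i x 0 i * v 0 i / _; set vv := \sum_i v 0 i * v 0 i / _.
set xx := \sum_i x 0 i * x 0 i / _.
have -> : \sum_i (x + s *: v) 0 i * v 0 i / D i = xv + s * vv.
  by rewrite mulr_sumr -big_split; apply: eq_bigr => i _; rewrite !mxE/= -/(D i); ring.
have -> : \sum_i (x + s *: v) 0 i * (x + s *: v) 0 i / D i =
    xx + 2 * s * xv + s ^+ 2 * vv.
  rewrite !mulr_sumr -!big_split.
  by apply: eq_bigr => i _; rewrite !mxE/= -/(D i); ring.
by ring.
Qed.

Lemma tangency0_gt0 x v : (forall i, 0 < a i) -> v != 0 -> inside a x ->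
  0 < tangency a x v 0.
Proof.
move=> a0 v0; rewrite /inside /= => xin.
have vv_ge0 i : 0 <= v 0 i * v 0 i / (a i - eps R i * 0).
  by rewrite mulr0 subr0 divr_ge0 ?(ltW (a0 i))// -expr2 sqr_ge0.
rewrite /tangency ltr_wpDl ?sqr_ge0// -mulrN opprB mulr_gt0 ?subr_gt0//.
have [j vj] := rV0Pn _ v0; rewrite dot_Amx (bigD1 j)//= ltr_pwDl ?sumr_ge0//.
by rewrite mulr0 subr0 divr_gt0// lt0r mulf_neq0//= -expr2 sqr_ge0.
Qed.

(* The factors of [t ^ (d - 1) * P.[t^-1]] and of [t ^ d * \prod_i (a_i - eps_i / t)]:
   in the variable [t = lam^-1] the coefficient of degree [d - 1] of [P] becomes
   a value at [t = 0], and a root at infinity becomes the root [t = 0]. *)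
Definition rev_root_factor (r : option R) : {poly R} :=
  if r is Some b then 1 - b *: 'X else 'X.

Lemma rev_root_factorE r t : t != 0 ->
  (rev_root_factor r).[t] = t * (root_factor r).[t^-1].
Proof. by case: r => [b|] t0; rewrite /= !hornerE//; field. Qed.

Definition rev_pole i : {poly R} := a i *: 'X - (eps R i)%:P.

Lemma eps_neq0 i : eps R i != 0.
Proof. by rewrite /eps; case: ifP => _; rewrite ?oppr_eq0 oner_neq0. Qed.

Lemma epsV i : (eps R i)^-1 = eps R i.
Proof. by rewrite /eps; case: ifP => _; rewrite ?invrN invr1. Qed.

Lemma prod_eps : \prod_(i < k + l) - eps R i = (-1) ^+ k :> R.
Proof.
rewrite big_split_ord /= [X in _ * X]big1 ?mulr1 => [|i _].
  rewrite (eq_bigr (fun=> -1)) ?prodr_const ?card_ord// => i _.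
  by rewrite /eps/= ltn_ord.
by rewrite /eps/= ltnNge leq_addr opprK.
Qed.

Lemma rev_pole_neq0 i : rev_pole i != 0.
Proof.
apply/eqP => /(congr1 (horner^~ 0)); rewrite /rev_pole !hornerE => /eqP.
by rewrite oppr_eq0 (negPf (eps_neq0 i)).
Qed.

(** Both sides are the coefficient of degree [k + l - 1] of the tangency polynomial, read off at
    [t = 0] after substituting [lam = t^-1]. *)
Lemma tangency_poly_lead x v c (alpha : (k + l).-1.-tuple (option R)) :
  (0 < k)%N ->
  tangency_poly a x v (c *: \prod_(r <- alpha) root_factor r) ->
  c * \prod_(r <- alpha) (rev_root_factor r).[0] = - (-1) ^+ k * pdot v v.
Proof.
move=> k0 tanP.
pose E := \prod_i rev_pole i.
pose E' i := \prod_(j | j != i) rev_pole j.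
pose S (f : 'I_(k + l) -> R) := \sum_i f i *: E' i.
pose xv := S (fun i => x 0 i * v 0 i); pose vv := S (fun i => v 0 i * v 0 i).
pose xx := S (fun i => x 0 i * x 0 i).
have E'E i : E = rev_pole i * E' i by rewrite /E (bigD1 i).
(* This is the tangency relation at [t^-1] multiplied by [E ^+ 2 / t]; each sum over [i] in it is
   [t / E] times a polynomial [S f]. *)
have : E * (c *: \prod_(r <- alpha) rev_root_factor r) =
    'X * (xv ^+ 2 - vv * xx) + E * vv.
  apply: (@horner_ext_nonroots _ _ _ ('X * E)).
    by rewrite mulf_neq0 ?polyX_eq0//; apply/prodf_neq0 => i _; exact: rev_pole_neq0.
  move=> t; rewrite rootM negb_or rootX => /andP[t0 Et].
  have Dt i : a i - eps R i * t^-1 = (rev_pole i).[t] / t.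
    by rewrite /rev_pole !hornerE; field.
  have Ei i : (rev_pole i).[t] != 0.
    by apply: contraNneq Et => Ei0; rewrite (E'E i) rootM rootE Ei0 eqxx.
  have D0 i : a i - eps R i * t^-1 != 0 by rewrite Dt mulf_neq0 ?invr_eq0.
  have SE f : \sum_i f i / (a i - eps R i * t^-1) = t / E.[t] * (S f).[t].
    rewrite /S horner_sum mulr_sumr; apply: eq_bigr => i _.
    rewrite Dt hornerZ (E'E i) hornerM; field.
    rewrite Ei t0 !andbT; apply: contraNneq Et => E'i0.
    by rewrite (E'E i) rootM orbC rootE E'i0 eqxx.
  have := tanP t^-1 D0; rewrite /tangency !dot_Amx !SE.
  have -> : \prod_i (a i - eps R i * t^-1) = E.[t] / t ^+ (k + l).
    rewrite (eq_bigr _ (fun i _ => Dt i)) big_split/= prodr_const card_ord.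
    by rewrite -horner_prod exprVn.
  have -> : (c *: \prod_(r <- alpha) root_factor r).[t^-1] =
      t / t ^+ (k + l) * (c *: \prod_(r <- alpha) rev_root_factor r).[t].
    rewrite !hornerZ !horner_prod (eq_bigr _ (fun r _ => rev_root_factorE r t0)).
    rewrite big_split/= big_const_seq count_predT iter_mulr_1 size_tuple.
    (* Each of the [k + l - 1] entries of [alpha], infinite ones included, supplies one factor
       [t]. *)
    have -> : t ^+ (k + l) = t * t ^+ (k + l).-1.
      by rewrite -exprS prednK ?addn_gt0 ?k0.
    by field; rewrite expf_neq0 t0.
  rewrite rootE in Et.
  rewrite !(hornerD, hornerM, hornerN, hornerX, horner_exp) -/xv -/vv -/xx.
  set G := (c *: _).[t] => tanE.
  have -> : E.[t] * G =
      E.[t] ^+ 2 / t * (t / t ^+ (k + l) * G / (E.[t] / t ^+ (k + l))).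
    by field; rewrite Et t0 expf_neq0.
  by rewrite -tanE; field; rewrite Et t0.
have EV i : (rev_pole i).[0] = - eps R i by rewrite /rev_pole !hornerE.
have E0 : E.[0] = (-1) ^+ k.
  by rewrite horner_prod (eq_bigr _ (fun i _ => EV i)) prod_eps.
have E'0 i : (E' i).[0] = - (-1) ^+ k * eps R i.
  rewrite -E0 (E'E i) hornerM EV -[X in _ * X]epsV; field; exact: eps_neq0.
(* At [t = 0] only [E * vv] survives on the right, and the signs in [(E' i).[0]] turn [vv] into a
   multiple of [pdot v v]. *)
move=> /(congr1 (horner^~ 0)).
rewrite !(hornerD, hornerM, hornerX) mul0r add0r E0 => /mulfI.
rewrite signr_eq0 hornerZ horner_prod => -> //.
rewrite horner_sum mulr_sumr; apply: eq_bigr => i _.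
by rewrite hornerZ E'0; ring.
Qed.

(** The witness is the value at 0 of the tangency polynomial; multiplying the leading coefficient
    identity by the root factors at 0 absorbs the unknown scalar left by [%=]. *)
Lemma line_caustics_pdot x v s (alpha : (k + l).-1.-tuple (option R)) :
  (0 < k)%N -> (forall i, 0 < a i) -> v != 0 -> inside a (x + s *: v) ->
  line_caustics a x v alpha ->
  exists2 p, 0 < p &
  p * \prod_(r <- alpha) (rev_root_factor r).[0] =
    - (-1) ^+ k * pdot v v * \prod_(r <- alpha) (root_factor r).[0].
Proof.
move=> k0 a0 v0 xin [P tanP /eqpf_eq[c _ PE]]; subst P.
have a_neq0 i : a i - eps R i * 0 != 0 by rewrite mulr0 subr0 gt_eqF.
exists (c * \prod_(r <- alpha) (root_factor r).[0]); last first.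
  by rewrite -(tangency_poly_lead k0 tanP); ring.
have := tangency0_gt0 a0 v0 xin; rewrite tangency_shift (tanP 0 a_neq0).
rewrite hornerZ horner_prod pmulr_lgt0// invr_gt0 prodr_gt0// => i _.
by rewrite mulr0 subr0.
Qed.

Lemma line_caustics_lightlike x v (alpha : (k + l).-1.-tuple (option R)) :
  (0 < k)%N -> line_caustics a x v alpha -> None \in alpha -> pdot v v = 0.
Proof.
move=> k0 [P tanP /eqpf_eq[c _ PE]] alphaN; subst P.
have := tangency_poly_lead k0 tanP.
rewrite (big_rem _ alphaN)/= hornerX mul0r mulr0 => /esym/eqP.
by rewrite mulf_eq0 oppr_eq0 signr_eq0 => /eqP.
Qed.

Lemma line_caustics_finite x v s (alpha : (k + l).-1.-tuple (option R))
    (beta : (k + l).-1.-tuple R) :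
  (0 < k)%N -> (forall i, 0 < a i) -> v != 0 -> inside a (x + s *: v) ->
  line_caustics a x v alpha -> alpha = map_tuple Some beta ->
  0 < pdot v v * ((-1) ^+ l * \prod_(r <- beta) r).
Proof.
move=> k0 a0 v0 xin /(line_caustics_pdot k0 a0 v0 xin)[p p0 + alphaE].
rewrite alphaE !big_map [X in p * X]big1 ?mulr1 => [pE|r _]; last first.
  by rewrite /rev_root_factor !hornerE subr0.
have prodE : \prod_(r <- beta) (root_factor (Some r)).[0] =
    (-1) ^+ (k + l).-1 * \prod_(r <- beta) r.
  rewrite (eq_bigr (fun r => -1 * r)) => [|r _]; last first.
    by rewrite /root_factor !hornerE mulN1r.
  by rewrite big_split/= big_const_seq count_predT iter_mulr_1 size_tuple.
(* The leading minus sign raises the exponent [(k + l).-1] to [k + l], and the two powers with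
   exponent [k] cancel. *)
have signE : - (-1) ^+ k * (-1) ^+ (k + l).-1 = (-1) ^+ l :> R.
  rewrite -mulN1r -mulrA mulrCA -exprS prednK ?addn_gt0 ?k0//.
  by rewrite exprD mulrA -expr2 sqrr_sign mul1r.
rewrite prodE in pE; suff -> : pdot v v * ((-1) ^+ l * \prod_(r <- beta) r) = p by [].
by rewrite pE -signE; ring.
Qed.

End ConfocalFamily.

Theorem theorem5p1 (R : realType) (k l : nat) (hk : (1 <= k)%N) (hl : (1 <= l)%N)
    (a : 'I_(k + l) -> R) (ha : admissible a)
    (alpha : (k + l).-1.-tuple (option R))
    (T : trajectory a) (hT : caustics T alpha) :
  exists tau : line_type,
    [/\ trajectory_of_type tau T,
        forall T' : trajectory a, caustics T' alpha -> trajectory_of_type tau T',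
        None \in alpha -> tau = LightLike,
        forall beta : (k + l).-1.-tuple R, alpha = map_tuple Some beta ->
          0 < (-1) ^+ l * \prod_(r <- beta) r -> tau = SpaceLike
      & forall beta : (k + l).-1.-tuple R, alpha = map_tuple Some beta ->
          (-1) ^+ l * \prod_(r <- beta) r < 0 -> tau = TimeLike].
Proof.
have [a0 _] := ha.
(* The midpoint of a segment is used because its endpoints may lie on the ellipsoid itself. *)
have mid (T' : trajectory a) n :
    inside a (vertex T' n + (flight_time T' n / 2) *: velocity T' n).
  apply: segment_inside; have t0 := flight_time_gt0 T' n.
  by rewrite divr_gt0//= ltr_pdivrMr// mulr_natr mulr2n ltrDl.
have [alphaN|alphaN] := boolP (None \in alpha).
  have light (T' : trajectory a) : caustics T' alpha -> trajectory_of_type LightLike T'.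
    move=> hT' n.
    exact: line_caustics_lightlike hk (hT' n) alphaN.
  have not_finite (beta : (k + l).-1.-tuple R) : alpha <> map_tuple Some beta.
    by move=> alphaE; move: alphaN; rewrite alphaE => /mapP[].
  exists LightLike; split => //; first exact: light.
    by move=> beta /not_finite.
  by move=> beta /not_finite.
(* The default 0 is never taken, since [None] does not occur in [alpha]. *)
pose beta := map_tuple (odflt 0) alpha.
have alphaE : alpha = map_tuple Some beta.
  apply: val_inj; rewrite /= -map_comp -[LHS]map_id; apply/eq_in_map => -[//|].
  by rewrite (negPf alphaN).
have pos (T' : trajectory a) n : caustics T' alpha ->
    0 < pdot (velocity T' n) (velocity T' n) * ((-1) ^+ l * \prod_(r <- beta) r).
  move=> hT'.
  exact: line_caustics_finite hk a0 (velocity_neq0 T' n) (mid T' n) (hT' n) alphaE.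
have betaE (gamma : (k + l).-1.-tuple R) : alpha = map_tuple Some gamma -> gamma = beta.
  rewrite alphaE => /(congr1 val)/= /inj_map H.
  by apply/esym/val_inj/H; exact: Some_inj.
have [neg|posb|zero] := ltgtP ((-1) ^+ l * \prod_(r <- beta) r) 0.
- have type (T' : trajectory a) : caustics T' alpha -> trajectory_of_type TimeLike T'.
    by move=> hT' n; have := pos T' n hT'; rewrite nmulr_lgt0.
  exists TimeLike; split => //; [exact: type|].
  by move=> gamma /betaE ->; rewrite ltNge ltW.
- have type (T' : trajectory a) : caustics T' alpha -> trajectory_of_type SpaceLike T'.
    by move=> hT' n; have := pos T' n hT'; rewrite pmulr_lgt0.
  exists SpaceLike; split => //; [exact: type|].
  by move=> gamma /betaE ->; rewrite ltNge ltW.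
(* A vanishing product is excluded by the initial segment of the given trajectory [T]. *)
- by have := pos T 0 hT; rewrite zero mulr0 ltxx.
Qed.
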